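(* Assume: (Balanced panel of groups) $N_{g,t}>0$ for all $(g,t)\in\{1,\ldots,G\}\times\{1,\ldots,T\}$. (Sharp design) $D_{i,g,t}=D_{g,t}$ for all $(g,t)$ and $i\in\{1,\ldots,N_{g,t}\}$. (Mean independence) $\mathrm{E}[Y_{g,t}(0)\mid\mathbf{D}]=\mathrm{E}[Y_{g,t}(0)\mid\mathbf{D}_g]$ for all $(g,t)\in\{1,\ldots,G\}\times\{2,\ldots,T\}$. (Strong exogeneity) $\mathrm{E}[Y_{g,t}(0)-Y_{g,t-1}(0)\mid\mathbf{D}_g]=\mathrm{E}[Y_{g,t}(0)-Y_{g,t-1}(0)]$ for all $(g,t)\in\{1,\ldots,G\}\times\{2,\ldots,T\}$. (Parallel trends) $\mathrm{E}[Y_{g,t}(0)-Y_{g,t-1}(0)]=\mathrm{E}[Y_{k,t}(0)-Y_{k,t-1}(0)]$ for all $g,k\in\{1,\ldots,G\}$ and $t\in\{2,\ldots,T\}$. (Staggered adoption) $D_{g,t}\ge D_{g,t-1}$ for all $g$ and $t\in\{2,\ldots,T\}$. (Patterns of misclassification) For all $g$, $t\in\{1,\ldots,T\}$, $i\in\{1,\ldots,N_{g,t}\}$: $\Pr(D^*_{i,g,t}=1\mid D_{g,t}=1)=1$; and for all $g$, $t\in\{2,\ldots,T\}$, $j\in\{1,\ldots,N_{g,t-1}\}$: $\Pr(D^*_{j,g,t-1}=0\mid D_{g,t}=0,D_{g,t-1}=0)=1$. (Existence of comparison groups) For every $t\in\{2,\ldots,T\}$ and $g$ with $D_{g,t-1}=0,D_{g,t}=1$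 there is $g'\neq g$ with $D_{g',t-1}=D_{g',t}=0$. (No misclassification in never treated) $\Pr(D^*_{i,g,T}=0\mid D_{g,T}=0)=1$ for all $g$ and $i\in\{1,\ldots,N_{g,T}\}$. (No observed switch in initial period) $\Pr(D_{g,1}=D_{g,2})=1$ for all $g$. Then $\mathrm{E}[\widehat{\mathrm{DID}}^{S}]=\delta^S$.
   Context: There are $G$ groups and $T$ periods. For each cell $(g,t)\in\{1,\ldots,G\}\times\{1,\ldots,T\}$ one observes $N_{g,t}$ units $i\in\{1,\ldots,N_{g,t}\}$. Each unit has real-valued random potential outcomes $Y_{i,g,t}(0),Y_{i,g,t}(1)$, a latent (true) binary treatment status $D^*_{i,g,t}$ and an observed binary treatment status $D_{i,g,t}$ which may differ from $D^*_{i,g,t}$. The observed outcome is $Y_{i,g,t}=D^*_{i,g,t}Y_{i,g,t}(1)+(1-D^*_{i,g,t})Y_{i,g,t}(0)$. Cell averages: $D_{g,t}=\frac1{N_{g,t}}\sum_{i=1}^{N_{g,t}}D_{i,g,t}$, and likewise $Y_{g,t}$, $Y_{g,t}(0)$. $\mathbf{D}_g=(D_{g,t})_{t\in\{1,\ldots,T\}}$, $\mathbf{D}=(D_{g,t})_{(g,t)\in\{1,\ldots,G\}\times\{1,\ldots,T\}}$. Counts: $N_S=\sum_{(g,t):t\ge2,D_{g,t}>D_{g,t-1}}N_{g,t}$; $N_{d,0,t}=\sum_{g:D_{g,t}=d,D_{g,t-1}=0}N_{g,t}$ and $N^{[1]}_{d,0,t}=\sum_{g:D_{g,t+1}=d,D_{g,t}=0}N_{g,t}$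 for $d\in\{0,1\}$. ATE of observed switchers: $\delta^S=\mathrm{E}\big[\frac1{N_S}\sum_{(i,g,t):t\ge2,D_{g,t}>D_{g,t-1}}(Y_{i,g,t}(1)-Y_{i,g,t}(0))\big]$. Estimator: $\widehat{\mathrm{DID}}^S=\frac1{N_S}\sum_{t\ge2}\widehat{\mathrm{DID}}^S_t$ with $$\widehat{\mathrm{DID}}^S_t=N_{1,0,t}\widehat{\mathrm{DID}}_t+N_{1,0,t}\widehat{\mathrm{DID}}^{*}_t+\frac{N^{[1]}_{1,0,t}N_{1,0,t}}{N_{0,0,t}}\widehat{\mathrm{DID}}^{**}_t,$$ $$\widehat{\mathrm{DID}}_t=\frac1{N_{1,0,t}}\sum_{g:D_{g,t}=1,D_{g,t-1}=0}N_{g,t}(Y_{g,t}-Y_{g,t-1})-\frac1{N_{0,0,t}}\sum_{g:D_{g,t}=0,D_{g,t-1}=0}N_{g,t}(Y_{g,t}-Y_{g,t-1}),$$ $$\widehat{\mathrm{DID}}^*_t=\frac1{N_{1,0,t}}\sum_{g:D_{g,t}=1,D_{g,t-1}=0}N_{g,t}(Y_{g,t-1}-Y_{g,t-2})-\frac1{N_{0,0,t}}\sum_{g:D_{g,t}=0,D_{g,t-1}=0}N_{g,t}(Y_{g,t-1}-Y_{g,t-2}),$$ $$\widehat{\mathrm{DID}}^{**}_t=\frac1{N^{[1]}_{1,0,t}}\sum_{g:D_{g,t+1}=1,D_{g,t}=0}N_{g,t}(Y_{g,t}-Y_{g,t-1})-\frac1{N^{[1]}_{0,0,t}}\sum_{g:D_{g,t+1}=0,D_{g,t}=0}N_{g,t}(Y_{g,t}-Y_{g,t-1}).$$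 Each of these three is set to zero whenever one of the two sets of groups it compares is empty; in particular $\widehat{\mathrm{DID}}^*_2=0$ and $\widehat{\mathrm{DID}}^{**}_T=0$, since observations before period $1$ and after period $T$ are unavailable.
   Formalization: Mean independence is assumed for all t in {1,…,T}, not only {2,…,T}: without it at t=1 the claim fails, since DID*_3 involves period-1 outcomes; potential outcomes are also assumed integrable, and ratios with N_S=0 are set to 0. *)

(* Defs.v *)
From HB Require Import structures.
From mathcomp Require Export all_boot all_order all_algebra.
From mathcomp Require Export all_classical all_reals all_analysis.
Export Order.TTheory GRing.Theory Num.Theory numFieldNormedType.Exports.

Set Implicit Arguments.
Unset Strict Implicit.
Unset Printing Implicit Defensive.

Local Open Scope classical_set_scope.
Local Open Scope ring_scope.

(* Meaningful only if [B] has positive probability (otherwise it is 0). *)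
Definition cond_prob d (Omega : measurableType d) (R : realType)
    (P : probability Omega R) (A B : set Omega) : R :=
  fine (P (A `&` B)) / fine (P B).

(* Pr(A | B) = 1 is a restriction only when the conditioning event has positive
   probability; events that never occur are left unconstrained. *)
Definition cond_sure d (Omega : measurableType d) (R : realType)
    (P : probability Omega R) (A B : set Omega) : Prop :=
  P B != 0%E -> cond_prob P A B = 1.

(* The random variable E[X | Z] for a discrete Z: at w it is the mean of X over
   the event {Z = Z w}.  It is used below for variables Z with finitely many
   values, so that the events of probability zero, on which the value is
   junk, form a negligible set; equalities between conditional
   expectations are accordingly stated almost surely. *)
Definition cond_exp d (Omega : measurableType d) (R : realType)
    (P : probability Omega R) (S : Type) (X : Omega -> R) (Z : Omega -> S)
    (w : Omega) : R :=
  (\int[P]_(x in Z @^-1` [set Z w]) X x) / fine (P (Z @^-1` [set Z w])).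

(* Periods are natural numbers, of which 1, ..., T are the ones observed; what
   the fields contain for other periods is irrelevant.  Cell sizes are not
   random. *)
Record panel d (Omega : measurableType d) (R : realType)
    (P : probability Omega R) (G : nat) := Panel {
  size_ : 'I_G -> nat -> nat;
  Y0 : forall (g : 'I_G) (t : nat), 'I_(size_ g t) -> {RV P >-> R};
  Y1 : forall (g : 'I_G) (t : nat), 'I_(size_ g t) -> {RV P >-> R};
  Dstar : forall (g : 'I_G) (t : nat), 'I_(size_ g t) -> {RV P >-> bool};
  Dobs : forall (g : 'I_G) (t : nat), 'I_(size_ g t) -> {RV P >-> bool} }.

Section Design.
Context d (Omega : measurableType d) (R : realType) (P : probability Omega R).
Context (G : nat) (X : panel P G).

Definition Yobs (g : 'I_G) (t : nat) (i : 'I_(size_ X g t)) (w : Omega) : R :=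
  (Dstar i w)%:R * Y1 i w + (1 - (Dstar i w)%:R) * Y0 i w.

Definition cell_mean (g : 'I_G) (t : nat) (f : 'I_(size_ X g t) -> R) : R :=
  (size_ X g t)%:R^-1 * \sum_(i < size_ X g t) f i.

Definition Dcell (g : 'I_G) (t : nat) (w : Omega) : R :=
  @cell_mean g t (fun i => (Dobs i w)%:R).

Definition Ycell (g : 'I_G) (t : nat) (w : Omega) : R :=
  @cell_mean g t (fun i => Yobs i w).

Definition Y0cell (g : 'I_G) (t : nat) (w : Omega) : R :=
  @cell_mean g t (fun i => Y0 i w).

(* Column j of these arrays is period j + 1. *)
Definition Dgroup (T : nat) (g : 'I_G) (w : Omega) : 'rV[R]_T :=
  \row_(j < T) Dcell g j.+1 w.

Definition Dall (T : nat) (w : Omega) : 'M[R]_(G, T) :=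
  \matrix_(g < G, j < T) Dcell g j.+1 w.

(* Observed status 0 in period t - 1 and e in period t. *)
Definition from0 (e : bool) (t : nat) (w : Omega) : {set 'I_G} :=
  [set g | (Dcell g t w == e%:R) && (Dcell g t.-1 w == 0)]%SET.

Definition N0 (e : bool) (t : nat) (w : Omega) : nat :=
  \sum_(g in from0 e t w) size_ X g t.

(* The groups are selected by their statuses in t and t + 1, but weighted by
   their sizes in t. *)
Definition N0next (e : bool) (t : nat) (w : Omega) : nat :=
  \sum_(g in from0 e t.+1 w) size_ X g t.

(* Number of units in the observed switching cells. *)
Definition NS (T : nat) (w : Omega) : nat :=
  \sum_(2 <= t < T.+1) \sum_(g < G | (Dcell g t.-1 w < Dcell g t w)%R) size_ X g t.

(* When there is no switching cell, both [switchers_mean_effect] and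
   [DID_S] below equal 0, because 0^-1 = 0. *)
Definition switchers_mean_effect (T : nat) (w : Omega) : R :=
  (NS T w)%:R^-1 *
  \sum_(2 <= t < T.+1) \sum_(g < G | (Dcell g t.-1 w < Dcell g t w)%R)
    \sum_(i < size_ X g t) (Y1 i w - Y0 i w).

Definition delta_S (T : nat) : \bar R := 'E_P[switchers_mean_effect T].

(* Difference between the means of h over the groups in A and over those in B,
   weighted by period-t sizes, and 0 if A or B is empty. *)
Definition diff_means (t : nat) (A B : {set 'I_G}) (h : 'I_G -> R) : R :=
  if (#|A| == 0%N) || (#|B| == 0%N) then 0 else
  (\sum_(g in A) size_ X g t)%N%:R^-1 * (\sum_(g in A) (size_ X g t)%:R * h g)
  - (\sum_(g in B) size_ X g t)%N%:R^-1 * (\sum_(g in B) (size_ X g t)%:R * h g).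

Definition DID (t : nat) (w : Omega) : R :=
  diff_means t (from0 true t w) (from0 false t w)
    (fun g => Ycell g t w - Ycell g t.-1 w).

(* Zero in period 2, as it would involve period 0. *)
Definition DID1 (t : nat) (w : Omega) : R :=
  if (t <= 2)%N then 0 else
  diff_means t (from0 true t w) (from0 false t w)
    (fun g => Ycell g t.-1 w - Ycell g t.-2 w).

(* Zero in period T, as it would involve period T + 1. *)
Definition DID2 (T t : nat) (w : Omega) : R :=
  if (T <= t)%N then 0 else
  diff_means t (from0 true t.+1 w) (from0 false t.+1 w)
    (fun g => Ycell g t w - Ycell g t.-1 w).

Definition DID_S_at (T t : nat) (w : Omega) : R :=
  (N0 true t w)%:R * DID t w + (N0 true t w)%:R * DID1 t w
  + (N0next true t w)%:R * (N0 true t w)%:R / (N0 false t w)%:R * DID2 T t w.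

Definition DID_S (T : nat) (w : Omega) : R :=
  (NS T w)%:R^-1 * \sum_(2 <= t < T.+1) DID_S_at T t w.

Definition integrable_outcomes (T : nat) : Prop :=
  forall (g : 'I_G) (t : nat) (i : 'I_(size_ X g t)), (1 <= t <= T)%N ->
    P.-integrable [set: Omega] (EFin \o Y0 i) /\
    P.-integrable [set: Omega] (EFin \o Y1 i).

Definition balanced_panel (T : nat) : Prop :=
  forall (g : 'I_G) (t : nat), (1 <= t <= T)%N -> (0 < size_ X g t)%N.

Definition sharp_design (T : nat) : Prop :=
  forall (g : 'I_G) (t : nat) (i : 'I_(size_ X g t)), (1 <= t <= T)%N ->
    {ae P, forall w, (Dobs i w)%:R = Dcell g t w}.

(* The conclusion requires this in period 1 as well as in periods 2, ..., T:
   DID1 at t = 3 involves outcomes of period 1. *)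
Definition mean_independence_at (T t : nat) : Prop :=
  forall g : 'I_G, {ae P, forall w,
    cond_exp P (Y0cell g t) (Dall T) w = cond_exp P (Y0cell g t) (Dgroup T g) w}.

Definition trend (g : 'I_G) (t : nat) (w : Omega) : R :=
  Y0cell g t w - Y0cell g t.-1 w.

Definition strong_exogeneity (T : nat) : Prop :=
  forall (g : 'I_G) (t : nat), (2 <= t <= T)%N ->
    {ae P, forall w, (cond_exp P (trend g t) (Dgroup T g) w)%:E = 'E_P[trend g t]%E}.

Definition parallel_trends (T : nat) : Prop :=
  forall (g k : 'I_G) (t : nat), (2 <= t <= T)%N ->
    'E_P[trend g t]%E = 'E_P[trend k t]%E.

Definition staggered_adoption (T : nat) : Prop :=
  {ae P, forall w, forall (g : 'I_G) (t : nat), (2 <= t <= T)%N ->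
    Dcell g t.-1 w <= Dcell g t w}.

Definition misclassification_patterns (T : nat) : Prop :=
  (forall (g : 'I_G) (t : nat) (i : 'I_(size_ X g t)), (1 <= t <= T)%N ->
     cond_sure P [set w | Dstar i w = true] [set w | Dcell g t w = 1]) /\
  (forall (g : 'I_G) (t : nat) (j : 'I_(size_ X g t.-1)), (2 <= t <= T)%N ->
     cond_sure P [set w | Dstar j w = false]
       [set w | Dcell g t w = 0 /\ Dcell g t.-1 w = 0]).

Definition comparison_groups_exist (T : nat) : Prop :=
  {ae P, forall w, forall (t : nat) (g : 'I_G), (2 <= t <= T)%N ->
    Dcell g t.-1 w = 0 -> Dcell g t w = 1 ->
    exists g' : 'I_G,
      [/\ g' <> g, Dcell g' t.-1 w = 0 & Dcell g' t w = 0]}.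

Definition no_misclassification_never_treated (T : nat) : Prop :=
  forall (g : 'I_G) (i : 'I_(size_ X g T)),
    cond_sure P [set w | Dstar i w = false] [set w | Dcell g T w = 0].

Definition no_initial_switch : Prop :=
  forall g : 'I_G, P [set w | Dcell g 1 w = Dcell g 2 w] = 1%E.

End Design.

(* Main.v *)
(** For each realised design, the estimator is a linear form in the changes of
    the cell means [Ycell].  Writing [Ycell = Y0cell + e], the form sends the
    changes of [e] to the mean effect among switchers: under staggered adoption
    [e] vanishes at an untreated cell followed by an untreated cell, so in
    period [t] it survives only in the switchers of [t], in their period
    [t - 1], and in the controls that switch in [t + 1].  [DID1] removes the
    second bias and [DID2] the third.  The form sends the changes of [Y0cell]
    to a variable with mean zero: given the design, their means depend on the
    period only, and the form kills what is common to all groups.  The design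
    takes finitely many values, so expectations are computed on its fibers. *)
Require Import Defs.
From mathcomp Require Import ring zify.

Set Implicit Arguments.
Unset Strict Implicit.
Unset Printing Implicit Defensive.

Local Open Scope classical_set_scope.
Local Open Scope ring_scope.

(** * Linear forms with finite support *)

Section LinearForms.
Context (R : realType) (I : eqType).
Implicit Types (A : pred I) (F : (I -> R) -> R) (h : I -> R).

(** Recording the set [A] of evaluation points allows hypotheses on [h] that hold only there, such
    as integrability in the observed periods. *)
Definition linear_form A F := exists2 s : seq (R * I),
  all (fun p => A p.2) s & forall h, F h = \sum_(p <- s) p.1 * h p.2.

Lemma linear_form_eval A (i : I) : A i -> linear_form A (fun h => h i).
Proof.
by move=> Ai; exists [:: (1, i)] => [|h]; rewrite ?big_seq1 ?mul1r//= Ai.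
Qed.

Lemma linear_form0 A : linear_form A (fun=> 0).
Proof. by exists [::] => // h; rewrite big_nil. Qed.

Lemma linear_formD A F1 F2 : linear_form A F1 -> linear_form A F2 ->
  linear_form A (fun h => F1 h + F2 h).
Proof.
move=> [s1 As1 F1E] [s2 As2 F2E]; exists (s1 ++ s2) => [|h].
  by rewrite all_cat As1.
by rewrite F1E F2E big_cat.
Qed.

Lemma linear_formZ A F (c : R) : linear_form A F ->
  linear_form A (fun h => c * F h).
Proof.
move=> [s As FE]; exists [seq (c * p.1, p.2) | p <- s] => [|h].
  by rewrite all_map.
by rewrite FE big_map mulr_sumr; apply: eq_bigr => p _; rewrite mulrA.
Qed.

Lemma linear_formB A F1 F2 : linear_form A F1 -> linear_form A F2 ->
  linear_form A (fun h => F1 h - F2 h).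
Proof.
move=> lF1 /(linear_formZ (-1)) lF2; have [s As FE] := linear_formD lF1 lF2.
by exists s => // h; rewrite -FE mulN1r.
Qed.

Lemma linear_form_sum A (J : Type) (r : seq J) (Q : pred J)
    (F : J -> (I -> R) -> R) :
  (forall j, Q j -> linear_form A (F j)) ->
  linear_form A (fun h => \sum_(j <- r | Q j) F j h).
Proof.
move=> lF; elim: r => [|j r [s As FE]].
  by exists [::] => // h; rewrite !big_nil.
case Qj: (Q j); last by exists s => // h; rewrite big_cons Qj.
have [s' As' FE'] : linear_form A (fun h => F j h + \sum_(i <- r | Q i) F i h).
  by apply: linear_formD; [exact: lF|exists s].
by exists s' => // h; rewrite big_cons Qj.
Qed.

Lemma linear_form_sub A F h1 h2 : linear_form A F ->
  F (fun i => h1 i - h2 i) = F h1 - F h2.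
Proof.
move=> [s _ FE]; rewrite !FE -sumrB.
by apply: eq_bigr => p _; rewrite mulrBr.
Qed.

Lemma eq_linear_form A F h1 h2 : linear_form A F ->
  (forall i, A i -> h1 i = h2 i) -> F h1 = F h2.
Proof.
move=> [s /allP As FE] h12; rewrite !FE.
by apply: eq_big_seq => p /As Ap; rewrite h12.
Qed.

End LinearForms.

(** * Exchange of linear forms and integrals *)

Section LinearFormIntegral.
Context d (Omega : measurableType d) (R : realType)
  (P : {measure set Omega -> \bar R}) (I : eqType).

Lemma linear_form_integrable (A : pred I) (F : (I -> R) -> R) B
    (h : I -> Omega -> R) : linear_form A F -> measurable B ->
  (forall i, A i -> P.-integrable B (EFin \o h i)) ->
  P.-integrable B (EFin \o (fun w => F (h^~ w))).
Proof.
move=> [s As FE] mB ih.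
have -> : EFin \o (fun w => F (h^~ w)) =
    (fun w => \sum_(p <- s | A p.2) p.1%:E * (h p.2 w)%:E)%E.
  apply/funext => w /=; rewrite FE -sumEFin big_seq_cond [RHS]big_seq_cond.
  apply: eq_bigl => p; rewrite andbT.
  by case ps: (p \in s) => //=; rewrite (allP As).
by apply: integrable_sum => // p Ap; apply: integrableZl => //; exact: ih.
Qed.

Lemma linear_form_Rintegral (A : pred I) (F : (I -> R) -> R) B
    (h : I -> Omega -> R) : linear_form A F -> measurable B ->
  (forall i, A i -> P.-integrable B (EFin \o h i)) ->
  \int[P]_(w in B) F (h^~ w) = F (fun i => \int[P]_(w in B) h i w).
Proof.
move=> [s As FE] mB ih; rewrite FE.
under eq_Rintegral do rewrite FE.
elim: s As {FE F} => [_|p s IH /= /andP[Ap As]].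
  under eq_Rintegral do rewrite big_nil.
  by rewrite big_nil Rintegral_cst// mul0r.
under eq_Rintegral do rewrite big_cons.
rewrite RintegralD//; last 2 first.
- exact: (integrableZl mB p.1 (ih _ Ap)).
- apply: (@linear_form_integrable A
    (fun h => \sum_(p <- s) p.1 * h p.2)) => //; by exists s.
by rewrite big_cons IH// RintegralZl//; exact: ih.
Qed.

End LinearFormIntegral.

(** * Integration over the fibers of a map with finite range *)

Section FiniteRange.
Context d (Omega : measurableType d) (R : realType)
  (P : {measure set Omega -> \bar R}) (S : eqType) (V : Omega -> S) (s : seq S).
Context (mV : forall v, measurable (V @^-1` [set v]))
  (sV : forall w, V w \in s).

Lemma sum_restrict_fibers (f : Omega -> R) w :
  f w = \sum_(v <- undup s) (f \_ (V @^-1` [set v])) w.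
Proof.
rewrite (bigD1_seq (V w)) ?mem_undup ?undup_uniq//= patchE mem_set//.
rewrite big1 ?addr0// => v vVw; rewrite patchE memNset//=.
by move=> /= Vwv; rewrite Vwv eqxx in vVw.
Qed.

(** Glues integrability for a function with a simple expression on each fiber but no uniform one, as
    when coefficients depend on the design. *)
Lemma integrable_fibers (f : Omega -> R) :
  (forall v, P.-integrable (V @^-1` [set v]) (EFin \o f)) ->
  P.-integrable setT (EFin \o f).
Proof.
move=> fi.
have -> : EFin \o f =
    (fun w => \sum_(v <- undup s) ((EFin \o f) \_ (V @^-1` [set v])) w)%E.
  apply/funext => w /=; rewrite [f w]sum_restrict_fibers -sumEFin.
  by apply: eq_bigr => v _; rewrite !patchE; case: ifP.
apply: integrable_sum => // v _.
by apply/(integrable_mkcond _ (mV v)); exact: fi.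
Qed.

Lemma Rintegral_fibers (f : Omega -> R) :
  (forall v, P.-integrable (V @^-1` [set v]) (EFin \o f)) ->
  \int[P]_w f w = \sum_(v <- undup s) \int[P]_(w in V @^-1` [set v]) f w.
Proof.
move=> fi; under eq_Rintegral do rewrite sum_restrict_fibers.
rewrite (@linear_form_Rintegral _ _ _ _ _ predT
  (fun h => \sum_(v <- undup s) h v))//.
- by apply: eq_bigr => v _; rewrite -Rintegral_mkcond.
- by apply: linear_form_sum => v _; exact: linear_form_eval.
move=> v _; move: (fi v) => /(integrable_mkcond _ (mV v)).
congr (is_true (integrable _ _ _)); apply/funext => w /=.
by rewrite !patchE; case: ifP.
Qed.

End FiniteRange.

(** * The estimator as a linear form with coefficients depending on the design *)

Section Estimator.
Context d (Omega : measurableType d) (R : realType) (P : probability Omega R).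
Context (G : nat) (X : panel P G).
Implicit Types (A B : {set 'I_G}) (w : Omega) (t T : nat) (h : 'I_G * nat -> R).

Definition did_form_at T t w h : R :=
  let dm e u := diff_means X t (from0 X true u w) (from0 X false u w)
    (fun g => h (g, e)) in
  (N0 X true t w)%:R * dm t t
  + (N0 X true t w)%:R * (if (t <= 2)%N then 0 else dm t.-1 t)
  + (N0next X true t w)%:R * (N0 X true t w)%:R / (N0 X false t w)%:R
    * (if (T <= t)%N then 0 else dm t t.+1).

(* [DID_S] as a linear form in the outcome changes: [h (g, t)] stands for the
   change from [t - 1] to [t] in group [g]. *)
Definition did_form T w h : R :=
  (NS X T w)%:R^-1 * \sum_(2 <= t < T.+1) did_form_at T t w h.

Definition change (y : 'I_G -> nat -> R) (p : 'I_G * nat) : R :=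
  y p.1 p.2 - y p.1 p.2.-1.

Lemma DID_S_form T w :
  DID_S X T w = did_form T w (change (fun g t => Ycell X g t w)).
Proof. by []. Qed.

Lemma diff_means_linear (Q : pred ('I_G * nat)) t u A B :
  (forall g, Q (g, u)) ->
  linear_form Q (fun h => diff_means X t A B (fun g => h (g, u))).
Proof.
move=> Qu; rewrite /diff_means.
case: ((#|A| == 0%N) || _); first exact: linear_form0.
by apply: linear_formB; apply: linear_formZ; apply: linear_form_sum => g _;
  apply: linear_formZ; exact: (@linear_form_eval _ _ Q (g, u)).
Qed.

Lemma linear_form_sum_periods (Q : pred ('I_G * nat)) T
    (F : nat -> ('I_G * nat -> R) -> R) :
  (forall t, (2 <= t <= T)%N -> linear_form Q (F t)) ->
  linear_form Q (fun h => \sum_(2 <= t < T.+1) F t h).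
Proof.
move=> lF.
have -> : (fun h => \sum_(2 <= t < T.+1) F t h) =
  (fun h => \sum_(t <- index_iota 2 T.+1 | (2 <= t <= T)%N) F t h).
  apply/funext => h; rewrite big_nat_cond [RHS]big_nat_cond.
  by apply: eq_bigl => t; rewrite ltnS andbT andbb.
exact: linear_form_sum.
Qed.

Definition observed_change T (p : 'I_G * nat) : bool := (2 <= p.2 <= T)%N.

Lemma did_form_linear T w : linear_form (observed_change T) (did_form T w).
Proof.
apply: linear_formZ.
apply: linear_form_sum_periods => t t2T.
apply: linear_formD; first apply: linear_formD.
- by apply: linear_formZ; exact: diff_means_linear.
(* In period 2 the form would read the change into period 1, which is not observed; the default 0
   removes it. *)
- apply: linear_formZ; have [t2|t2] := leqP t 2; first exact: linear_form0.
  by apply: diff_means_linear => g; rewrite /observed_change /=; lia.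
- apply: linear_formZ; have [tT|tT] := leqP T t; first exact: linear_form0.
  exact: diff_means_linear.
Qed.

(** The weights on each side add up to 1, as positive sizes make the totals nonzero, so both means
    are [c]; an empty side gives 0 by default. *)
Lemma diff_means_const t A B (c : R) :
  (forall g : 'I_G, 0 < size_ X g t)%N -> diff_means X t A B (fun=> c) = 0.
Proof.
move=> size_gt0; rewrite /diff_means; case: ifPn => //.
rewrite negb_or => /andP[A0 B0].
suff mean (C : {set 'I_G}) : #|C| != 0%N ->
    (\sum_(g in C) size_ X g t)%N%:R^-1 * (\sum_(g in C) (size_ X g t)%:R * c)
    = c by rewrite !mean// subrr.
rewrite -lt0n => /card_gt0P[g gC].
rewrite -mulr_suml -natr_sum mulKf// pnatr_eq0 -lt0n.
by rewrite (bigD1 g)//= ltn_addr.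
Qed.

Lemma did_form_common T w h : balanced_panel X T ->
  (forall g k t, (2 <= t <= T)%N -> h (g, t) = h (k, t)) ->
  did_form T w h = 0.
Proof.
move=> bal hc.
have [c hE] : exists c : nat -> R,
    forall p, observed_change T p -> h p = c p.2.
  case: (pickP (@predT 'I_G)) => [g0 _|noG].
    by exists (fun t => h (g0, t)) => -[g t]; exact: hc.
  by exists (fun=> 0) => -[g t]; have := noG g.
rewrite (eq_linear_form (did_form_linear T w) hE).
rewrite /did_form big_nat big1 ?mulr0// => t t2T.
have size_gt0 g : (0 < size_ X g t)%N by apply: bal; lia.
by rewrite /did_form_at /= !diff_means_const// !if_same !mulr0 !addr0.
Qed.

Section SameDesign.
Context (T : nat) (w w' : Omega) (DallE : Dall X T w = Dall X T w').

Lemma Dcell_eq g t : (1 <= t <= T)%N -> Dcell X g t w = Dcell X g t w'.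
Proof.
case: t => // t tT.
by move/matrixP: DallE => /(_ g (Ordinal tT)); rewrite !mxE.
Qed.

Lemma from0_eq e t : (2 <= t <= T)%N -> from0 X e t w = from0 X e t w'.
Proof. by move=> tT; apply/setP => g; rewrite !inE !Dcell_eq//; lia. Qed.

Lemma NS_eq : NS X T w = NS X T w'.
Proof.
rewrite /NS big_nat [RHS]big_nat; apply: eq_bigr => t t2T.
by apply: eq_bigl => g; rewrite !Dcell_eq//; lia.
Qed.

(** The coefficients see [w] only through the design, so on a fiber of [Dall] they may be frozen at
    any representative. *)
Lemma did_form_eq h : did_form T w h = did_form T w' h.
Proof.
rewrite /did_form NS_eq; congr (_ * _).
rewrite big_nat [RHS]big_nat; apply: eq_bigr => t t2T.
rewrite /did_form_at /N0next /N0 !(@from0_eq _ t)//.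
(* Statuses in [T + 1] are not part of the design, so selections based on them may differ; for
   [t = T] the default 0 cancels them. *)
have [tT|tT] := leqP T t; first by rewrite !mulr0.
by rewrite !(@from0_eq _ t.+1)//; lia.
Qed.

End SameDesign.

(** The sum over the units of a cell is its size times the cell mean, so [switchers_mean_effect] is
    this form at the mean effects of the cells. *)
Definition switchers_form T w h : R :=
  (NS X T w)%:R^-1 *
  \sum_(2 <= t < T.+1) \sum_(g < G | (Dcell X g t.-1 w < Dcell X g t w)%R)
    (size_ X g t)%:R * h (g, t).

Lemma switchers_form_eq T w w' h : Dall X T w = Dall X T w' ->
  switchers_form T w h = switchers_form T w' h.
Proof.
move=> DE; rewrite /switchers_form (NS_eq DE); congr (_ * _).
rewrite big_nat [RHS]big_nat; apply: eq_bigr => t t2T.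
by apply: eq_bigl => g; rewrite !(Dcell_eq DE)//; lia.
Qed.

Lemma switchers_form_linear T w :
  linear_form (observed_change T) (switchers_form T w).
Proof.
apply: linear_formZ.
apply: linear_form_sum_periods => t t2T; apply: linear_form_sum => g _.
by apply: linear_formZ; exact: linear_form_eval.
Qed.

(** * Image of the treatment effect under the form, at one realised design *)

Section TreatmentEffect.
Context (T : nat) (w : Omega) (e : 'I_G -> nat -> R).
Context (bal : balanced_panel X T)
  (D01 : forall g t, (1 <= t <= T)%N ->
     Dcell X g t w = 0 \/ Dcell X g t w = 1)
  (stag : forall g t, (2 <= t <= T)%N -> Dcell X g t.-1 w <= Dcell X g t w)
  (comp : forall t (g : 'I_G), (2 <= t <= T)%N ->
     Dcell X g t.-1 w = 0 -> Dcell X g t w = 1 ->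
     exists g' : 'I_G,
       [/\ g' <> g, Dcell X g' t.-1 w = 0 & Dcell X g' t w = 0])
  (init : forall g, Dcell X g 1 w = Dcell X g 2 w)
  (e0 : forall g t, (2 <= t <= T)%N -> Dcell X g t w = 0 ->
     Dcell X g t.-1 w = 0 -> e g t.-1 = 0)
  (eT : forall g, Dcell X g T w = 0 -> e g T = 0).

Let S t := from0 X true t w.
Let C t := from0 X false t w.

Lemma in_switchers g t : (g \in S t) =
  (Dcell X g t w == 1) && (Dcell X g t.-1 w == 0).
Proof. by rewrite inE. Qed.

Lemma in_controls g t : (g \in C t) =
  (Dcell X g t w == 0) && (Dcell X g t.-1 w == 0).
Proof. by rewrite inE. Qed.

(** Wherever there are switchers, the comparison is a genuine difference and not the default 0,
    which would lose the switchers' term. *)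
Lemma controls_neq0 t : (2 <= t <= T)%N ->
  S t != finset.set0 -> C t != finset.set0.
Proof.
move=> t2T /set0Pn[g]; rewrite in_switchers => /andP[/eqP D1 /eqP D0].
have [g' [_ D0' D0'']] := comp t2T D0 D1.
by apply/set0Pn; exists g'; rewrite in_controls D0' D0'' eqxx.
Qed.

Let wsum t A (h : 'I_G -> R) := \sum_(g in A) (size_ X g t)%:R * h g.

(** Multiplying by the total size of [A] clears its normalisation; the other side keeps the ratio of
    totals, which the factor in front of [DID2] will match. *)
Lemma diff_means_scaled t A B (h : 'I_G -> R) : (1 <= t <= T)%N ->
  A != finset.set0 -> B != finset.set0 ->
  (\sum_(g in A) size_ X g t)%N%:R * diff_means X t A B h =
  wsum t A h - (\sum_(g in A) size_ X g t)%N%:R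
               / (\sum_(g in B) size_ X g t)%N%:R * wsum t B h.
Proof.
move=> t1T A0 B0; rewrite /diff_means !cards_eq0 (negbTE A0) (negbTE B0) /=.
rewrite mulrBr mulVKf ?mulrA// pnatr_eq0 -lt0n.
by case/set0Pn: A0 => g gA; rewrite (bigD1 g)//= ltn_addr// bal.
Qed.

Lemma wsum0 t A (h : 'I_G -> R) :
  (forall g, g \in A -> h g = 0) -> wsum t A h = 0.
Proof. by move=> h0; rewrite /wsum big1// => g /h0 ->; rewrite mulr0. Qed.

(* The controls of period [t] are those that switch in [t + 1], whose possible
   misclassification in [t] is what [DID2] measures, and those that do not,
   which are untreated in [t]. *)
Lemma wsum_controls t : (2 <= t < T)%N ->
  wsum t (C t) (e^~ t) = wsum t (S t.+1) (e^~ t).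
Proof.
move=> t2T; rewrite /wsum (bigID (mem (S t.+1)))/= [X in _ + X]big1 ?addr0.
  apply: eq_bigl => g; rewrite in_controls in_switchers.
  have : Dcell X g t.-1 w <= Dcell X g t w by apply: stag; lia.
  have [|->|->] := D01 g (t := t.-1); first lia.
    by case: (Dcell X g t w == 0); rewrite ?andbF ?andbT//= eqxx.
  case: eqP => [->|//]; first by rewrite ler10.
  by rewrite andbF.
move=> g; rewrite in_controls in_switchers => /andP[/andP[/eqP Dt /eqP Dt1]].
have [|Dt'|->] := D01 g (t := t.+1); first lia; last by rewrite Dt !eqxx.
by move=> _; rewrite (e0 _ Dt')// ?mulr0//; lia.
Qed.

Lemma Dcell_pred0 g t : (2 <= t <= T)%N ->
  Dcell X g t w = 0 -> Dcell X g t.-1 w = 0.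
Proof.
move=> t2T Dt; have := stag g t2T; rewrite Dt.
by have [|->//|->] := D01 g (t := t.-1); [lia|rewrite ler10].
Qed.

(** Switchers and controls of [t] are both untreated in [t - 1], hence in [t - 2] by staggered
    adoption, so [DID1] brings in no bias from [t - 2]. *)
Lemma effect_before g t : (3 <= t <= T)%N ->
  Dcell X g t.-1 w = 0 -> e g t.-2 = 0.
Proof.
move=> t3T Dt1; have t1 : (2 <= t.-1 <= T)%N by lia.
exact: (e0 t1 Dt1 (Dcell_pred0 t1 Dt1)).
Qed.

(** With [r] the ratio of switching to control units, [DID] yields the switchers' effect in [t],
    minus their bias in [t - 1], minus [r] times the controls' bias in [t]. [DID1] restores the
    second term and [DID2] the third. *)
Lemma did_form_at_effect t : (2 <= t <= T)%N ->
  did_form_at T t w (change e) = wsum t (S t) (e^~ t).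
Proof.
move=> t2T; rewrite /did_form_at -/(S t) -/(C t) -/(S t.+1) -/(C t.+1).
have [S0|S0] := eqVneq (S t) finset.set0.
  by rewrite /N0 /wsum -/(S t) S0 !big_set0 !mul0r !mulr0 !mul0r !addr0.
have C0 := controls_neq0 t2T S0.
have t1T : (1 <= t <= T)%N by lia.
(* The absence of switches between periods 1 and 2 rules out [t = 2], so [DID1] is not at its
   default. *)
have t3T : (3 <= t <= T)%N.
  suff : t <> 2%N by lia.
  move=> t2; case/set0Pn: S0 => g; rewrite in_switchers t2 /= -init.
  by case: eqP => //= ->; rewrite oner_eq0.
rewrite ifF; last lia.
rewrite /N0 -/(S t) -/(C t) !diff_means_scaled//.
set r := _ / _.
have wsumB u A (h1 h2 : 'I_G -> R) :
    wsum u A (fun g => h1 g - h2 g) = wsum u A h1 - wsum u A h2.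
  by rewrite -sumrB; apply: eq_bigr => g _; rewrite mulrBr.
rewrite /change/= !wsumB.
rewrite [wsum t (S t) (e^~ t.-2)]wsum0; last first.
  by move=> g; rewrite in_switchers => /andP[_ /eqP]; exact: effect_before.
rewrite [wsum t (C t) (e^~ t.-2)]wsum0; last first.
  by move=> g; rewrite in_controls => /andP[_ /eqP]; exact: effect_before.
rewrite [wsum t (C t) (e^~ t.-1)]wsum0; last first.
  by move=> g; rewrite in_controls => /andP[/eqP Dt /eqP]; exact: e0.
(* [z] is the contribution of [DID2]. The switchers' terms in [t - 1] cancel between [DID] and
   [DID1], so only the controls' term in [t] is left to offset. *)
set z := _ * (if _ then _ else _).
suff -> : z = r * wsum t (C t) (e^~ t) by ring.
(* In the last period [DID2] is 0, but groups observed untreated in [T] are truly untreated and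
   carry no bias. *)
rewrite {}/z; have [Tt|tT] := leqP T t.
  have -> : t = T by lia.
  rewrite mulr0 wsum0 ?mulr0// => g.
  by rewrite in_controls => /andP[/eqP DT _]; exact: eT.
rewrite wsum_controls; last lia.
have [S1|S1] := eqVneq (S t.+1) finset.set0.
  by rewrite /N0next -/(S t.+1) S1 /wsum !big_set0 !mul0r mulr0.
have C1 : C t.+1 != finset.set0 by apply: controls_neq0 => //; lia.
(* Regroups the weight of [DID2] as [r] times the total size of the next switchers, the scaling that
   clears the normalisation. *)
rewrite -[_ / _]mulrA [X in X * _]mulrC -mulrA diff_means_scaled//.
rewrite -/r; congr (r * _); rewrite !wsumB.
have prev0 g : Dcell X g t w = 0 -> e g t.-1 = 0.
  by move=> Dt; exact: (e0 t2T Dt (Dcell_pred0 t2T Dt)).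
rewrite [wsum t (S t.+1) (e^~ t.-1)]wsum0; last first.
  by move=> g; rewrite in_switchers => /andP[_ /eqP]; exact: prev0.
rewrite [wsum t (C t.+1) (e^~ t.-1)]wsum0; last first.
  by move=> g; rewrite in_controls => /andP[_ /eqP]; exact: prev0.
rewrite [wsum t (C t.+1) (e^~ t)]wsum0; first by rewrite !subr0 mulr0 subr0.
move=> g; rewrite in_controls => /andP[/eqP Dt1 /eqP Dt].
by apply: e0 Dt1 Dt; lia.
Qed.

Lemma did_form_effect :
  did_form T w (change e) = switchers_form T w (fun p => e p.1 p.2).
Proof.
rewrite /did_form /switchers_form; congr (_ * _).
rewrite big_nat [RHS]big_nat; apply: eq_bigr => t t2T.
rewrite did_form_at_effect//; apply: eq_bigl => g; rewrite in_switchers.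
have t0T : (1 <= t.-1 <= T)%N by lia.
have t1T : (1 <= t <= T)%N by lia.
(* Since statuses are 0 or 1, a strict increase is exactly a move from 0 to 1. *)
by have [->|->] := D01 g t0T; have [->|->] := D01 g t1T;
  rewrite ?eqxx ?oner_eq0 ?(eq_sym 0) ?oner_eq0 ?ltxx ?ltr01 ?ltr10 ?andbF.
Qed.

End TreatmentEffect.
End Estimator.

(** * Almost sure statements and conditioning events *)

Section Probability.
Context d (Omega : measurableType d) (R : realType) (P : probability Omega R).

(** Lets an almost sure identity be read at one point of a fiber of positive probability, which
    suffices for conditional expectations since they are constant on fibers. *)
Lemma ae_witness (Q : set Omega) B : measurable B -> P B != 0%E ->
  {ae P, forall w, Q w} -> exists2 w, B w & Q w.
Proof.
move=> mB PB0 Qae; apply/exists2P; apply: contrapT => /forallNP BQ.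
have : P.-negligible B by apply: negligibleS Qae => w Bw Qw; apply: (BQ w).
by move/(negligibleP P mB)/eqP; rewrite (negbTE PB0).
Qed.

Lemma ae_forall_countable (I : countType) (Q : I -> set Omega) :
  (forall i, {ae P, forall w, Q i w}) -> {ae P, forall w, forall i, Q i w}.
Proof.
move=> Qae.
have : {ae P, forall w, forall n, if unpickle n is Some i then Q i w else True}.
  by apply: ae_foralln => n; case: unpickle => [i|]; [exact: Qae|exact: aeW].
by apply: filterS => w Qw i; have := Qw (pickle i); rewrite pickleK.
Qed.

(** The part of [B] outside [A] is null: its measure is [P B] minus that of the intersection, and
    when [P B] is 0, where [cond_sure] says nothing, it lies in a null set. *)
Lemma cond_sure_ae (A B : set Omega) : measurable A -> measurable B ->
  cond_sure P A B -> {ae P, forall w, B w -> A w}.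
Proof.
move=> mA mB sure.
suff BA0 : P (B `\` A) = 0%E.
  exists (B `\` A); split=> //; first exact: measurableD.
  by move=> w /= /not_implyP.
have [PB0|PB0] := eqVneq (P B) 0%E.
  by apply: (subset_measure0 _ mB) => //; exact: measurableD.
have PBfin : P B \is a fin_num by exact: fin_num_measure.
have PABfin : P (A `&` B) \is a fin_num.
  by apply: fin_num_measure; exact: measurableI.
have fPB0 : fine (P B) != 0 by rewrite fine_eq0.
move: (sure PB0); rewrite /cond_prob => /divr1_eq PAB.
rewrite measureD// ?ltey_eq ?PBfin// setIC.
apply: etrans (subee PBfin); congr (_ - _)%E.
by rewrite -[LHS](fineK PABfin) -[RHS](fineK PBfin) PAB.
Qed.


Lemma measurable_fun_bool (D : {RV P >-> bool}) :
  measurable_fun setT (fun w => (D w)%:R : R).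
Proof.
have mb : measurable_fun setT (fun b : bool => b%:R : R) by move=> _ Y _.
exact: (measurableT_comp mb (measurable_funPT D)).
Qed.

Lemma measurable_bool_event (D : {RV P >-> bool}) (b : bool) :
  measurable (D @^-1` [set b]).
Proof. by rewrite -[X in measurable X]setTI; apply: (measurable_funPT D). Qed.

End Probability.

(** * Measurability and finite range of the design *)

Section Panel.
Context d (Omega : measurableType d) (R : realType) (P : probability Omega R).
Context (G : nat) (X : panel P G) (T : nat).

Lemma measurable_Dcell g t : measurable_fun setT (Dcell X g t).
Proof.
apply: measurable_realfun.measurable_funM; first exact: measurable_cst.
by apply: measurable_sum => i; exact: measurable_fun_bool.
Qed.

Lemma measurable_Dcell_event g t (c : R) :
  measurable [set w | Dcell X g t w = c].
Proof.
rewrite -[X in measurable X]setTI.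
exact: (measurable_Dcell g t measurableT (measurable_set1 c)).
Qed.

Lemma measurable_Dall_fiber v : measurable (Dall X T @^-1` [set v]).
Proof.
have -> : Dall X T @^-1` [set v] = \bigcap_(p in [set: 'I_G * 'I_T])
    [set w | Dcell X p.1 p.2.+1 w = v p.1 p.2].
  apply/seteqP; split=> w /= Hw; first by move=> p _ /=; rewrite -Hw mxE.
  by apply/matrixP => g j; rewrite mxE; exact: (Hw (g, j)).
by apply: fin_bigcap_measurable => // p _; exact: measurable_Dcell_event.
Qed.

Lemma measurable_Dgroup_fiber g v : measurable (Dgroup X T g @^-1` [set v]).
Proof.
have -> : Dgroup X T g @^-1` [set v] = \bigcap_(j in [set: 'I_T])
    [set w | Dcell X g j.+1 w = v 0 j].
  apply/seteqP; split=> w /= Hw; first by move=> j _ /=; rewrite -Hw mxE.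
  by apply/rowP => j; rewrite mxE; exact: Hw.
by apply: fin_bigcap_measurable => // j _; exact: measurable_Dcell_event.
Qed.

Let cell_unit (p : 'I_G * 'I_T) := 'I_(size_ X p.1 p.2.+1).

(** Every assignment of statuses to units contributes a design, so that membership holds at all
    outcomes and not just almost surely. *)
Definition Dall_range : seq 'M[R]_(G, T) :=
  [seq \matrix_(g < G, j < T)
     @cell_mean _ _ _ _ _ X g j.+1
       (fun i => (f (Tagged cell_unit (i : cell_unit (g, j))))%:R)
  | f : {ffun {p : 'I_G * 'I_T & cell_unit p} -> bool}].

Lemma Dall_in_range w : Dall X T w \in Dall_range.
Proof.
apply/fintype.imageP; exists [ffun p => Dobs (tagged p) w] => //.
apply/matrixP => g j; rewrite !mxE /Dcell /cell_mean; congr (_ * _).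
by apply: eq_bigr => i _; rewrite ffunE.
Qed.

End Panel.

(** * Almost sure form of the estimation error *)

Section Unbiasedness.
Context d (Omega : measurableType d) (R : realType) (P : probability Omega R).
Context (G T : nat) (X : panel P G).

Definition Y1cell (g : 'I_G) (t : nat) (w : Omega) : R :=
  @cell_mean _ _ _ _ _ X g t (fun i => Y1 i w).

Lemma switchers_mean_effect_form w : balanced_panel X T ->
  switchers_mean_effect X T w =
  switchers_form X T w (fun p => Y1cell p.1 p.2 w - Y0cell X p.1 p.2 w).
Proof.
move=> bal; rewrite /switchers_mean_effect /switchers_form; congr (_ * _).
rewrite big_nat [RHS]big_nat; apply: eq_bigr => t t2T; apply: eq_bigr => g _ /=.
rewrite -mulrBr -sumrB mulVKf// pnatr_eq0 -lt0n; apply: bal; lia.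
Qed.

(** Pointwise form of the almost sure assumptions on statuses; it makes the argument on treatment
    effects deterministic. *)
Record regular (w : Omega) : Prop := Regular {
  regular01 : forall g t, (1 <= t <= T)%N ->
    Dcell X g t w = 0 \/ Dcell X g t w = 1;
  regular_staggered : forall g t, (2 <= t <= T)%N ->
    Dcell X g t.-1 w <= Dcell X g t w;
  regular_comparison : forall t g, (2 <= t <= T)%N ->
    Dcell X g t.-1 w = 0 -> Dcell X g t w = 1 ->
    exists g' : 'I_G,
      [/\ g' <> g, Dcell X g' t.-1 w = 0 & Dcell X g' t w = 0];
  regular_initial : forall g, Dcell X g 1 w = Dcell X g 2 w;
  regular_treated : forall g t (i : 'I_(size_ X g t)), (1 <= t <= T)%N ->
    Dcell X g t w = 1 -> Dstar i w = true;
  regular_untreated : forall g t (i : 'I_(size_ X g t.-1)), (2 <= t <= T)%N ->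
    Dcell X g t w = 0 -> Dcell X g t.-1 w = 0 -> Dstar i w = false;
  regular_never : forall g (i : 'I_(size_ X g T)),
    Dcell X g T w = 0 -> Dstar i w = false }.

Lemma ae_regular : balanced_panel X T -> sharp_design X T ->
  staggered_adoption X T -> misclassification_patterns X T ->
  comparison_groups_exist X T -> no_misclassification_never_treated X T ->
  no_initial_switch X -> {ae P, forall w, regular w}.
Proof.
move=> bal sharp stag [treated untreated] comp never init.
have ae01 : {ae P, forall w, forall g t, (1 <= t <= T)%N ->
    Dcell X g t w = 0 \/ Dcell X g t w = 1}.
  apply: ae_forall_countable => g; apply: ae_forall_countable => t.
  have [t1T|_] := boolP (1 <= t <= T)%N; last exact: aeW.
  (* Balance provides a first unit in the cell; by sharpness its binary status is the cell mean. *)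
  apply: filterS (sharp g t (Ordinal (bal g t t1T)) t1T) => w <- _.
  by case: (Dobs _ w); [right|left].
have ae_init : {ae P, forall w, forall g, Dcell X g 1 w = Dcell X g 2 w}.
  apply: ae_forall_countable => g.
  have mI : measurable [set w | Dcell X g 1 w = Dcell X g 2 w].
    have mB : measurable_fun setT (Dcell X g 1 \- Dcell X g 2).
      by apply: measurable_realfun.measurable_funB; exact: measurable_Dcell.
    have := mB measurableT _ (measurable_set1 0); rewrite setTI.
    congr measurable; apply/seteqP; split=> w /=; first exact: subr0_eq.
    by move=> ->; rewrite subrr.
  exists (~` [set w | Dcell X g 1 w = Dcell X g 2 w]); split => //.
    exact: measurableC.
  by rewrite probability_setC// init subee.
have ae_treated : {ae P, forall w, forall g t (i : 'I_(size_ X g t)),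
    (1 <= t <= T)%N -> Dcell X g t w = 1 -> Dstar i w = true}.
  apply: ae_forall_countable => g; apply: ae_forall_countable => t.
  apply: ae_forall_countable => i.
  have [t1T|_] := boolP (1 <= t <= T)%N; last exact: aeW.
  have := cond_sure_ae (measurable_bool_event (Dstar i) true)
    (measurable_Dcell_event X g t 1) (treated g t i t1T).
  by apply: filterS => w + _.
have ae_untreated : {ae P, forall w, forall g t (i : 'I_(size_ X g t.-1)),
    (2 <= t <= T)%N -> Dcell X g t w = 0 -> Dcell X g t.-1 w = 0 ->
    Dstar i w = false}.
  apply: ae_forall_countable => g; apply: ae_forall_countable => t.
  apply: ae_forall_countable => i.
  have [t2T|_] := boolP (2 <= t <= T)%N; last exact: aeW.
  have := cond_sure_ae (measurable_bool_event (Dstar i) false)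
    (measurableI _ _ (measurable_Dcell_event X g t 0)
      (measurable_Dcell_event X g t.-1 0)) (untreated g t i t2T).
  by apply: filterS => w untreated_w _ D1 D2; exact: untreated_w.
have ae_never : {ae P, forall w, forall g (i : 'I_(size_ X g T)),
    Dcell X g T w = 0 -> Dstar i w = false}.
  apply: ae_forall_countable => g; apply: ae_forall_countable => i.
  exact: (cond_sure_ae (measurable_bool_event (Dstar i) false)
    (measurable_Dcell_event X g T 0) (never g i)).
near=> w; split; near: w => //.
Unshelve. all: by end_near.
Qed.

(** The gap [e] between observed and untreated cell means satisfies the hypotheses of
    [did_form_effect] and equals the mean effect in switching cells, so the form sends its changes
    to the switchers' effect. Linearity leaves the changes of [Y0cell]. *)
Lemma DID_S_regular w : balanced_panel X T -> regular w ->
  DID_S X T w - switchers_mean_effect X T w =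
  did_form X T w (change (fun g t => Y0cell X g t w)).
Proof.
move=> bal reg; apply/eqP; rewrite subr_eq; apply/eqP.
pose e g t := Ycell X g t w - Y0cell X g t w.
have Ycell0 g t : (forall i : 'I_(size_ X g t), Dstar i w = false) -> e g t = 0.
  move=> untreated; apply/eqP; rewrite subr_eq0 /Ycell /Y0cell /cell_mean.
  under eq_bigr do rewrite /Yobs untreated mul0r add0r subr0 mul1r.
  exact: eqxx.
have e1 g t : (forall i : 'I_(size_ X g t), Dstar i w = true) ->
    e g t = Y1cell g t w - Y0cell X g t w.
  move=> treated; congr (_ - _); rewrite /Ycell /Y1cell /cell_mean.
  congr (_ * _).
  by apply: eq_bigr => i _; rewrite /Yobs treated mul1r subrr mul0r addr0.
have -> : switchers_mean_effect X T w = did_form X T w (change e).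
  rewrite did_form_effect//.
  - rewrite switchers_mean_effect_form// /switchers_form; congr (_ * _).
    rewrite big_nat [RHS]big_nat; apply: eq_bigr => t t2T.
    apply: eq_bigr => g lt_D.
    have t1T : (1 <= t <= T)%N by lia.
    have t0T : (1 <= t.-1 <= T)%N by lia.
    have D1 : Dcell X g t w = 1.
      case: (regular01 reg g t1T) (regular01 reg g t0T) lt_D => -> // [] ->.
        by rewrite ltxx.
      by rewrite ltr10.
    by rewrite /= e1// => i; exact: (regular_treated reg).
  - exact: regular01 reg.
  - exact: regular_staggered reg.
  - exact: regular_comparison reg.
  - exact: regular_initial reg.
  - by move=> g t t2T D1 D0; apply: Ycell0 => i; exact: (regular_untreated reg).
  - by move=> g DT; apply: Ycell0 => i; exact: (regular_never reg).
rewrite DID_S_form; apply/eqP; rewrite -subr_eq.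
rewrite -(linear_form_sub _ _ (did_form_linear X T w)); apply/eqP.
by congr did_form; apply/funext => p; rewrite /change /e; ring.
Qed.

End Unbiasedness.

(** * Integrability, and the mean trend given the design *)

Section Expectation.
Context d (Omega : measurableType d) (R : realType) (P : probability Omega R).
Context (G T : nat) (X : panel P G).
Context (hint : integrable_outcomes X T).

Lemma integrable_cell_mean g t (f : 'I_(size_ X g t) -> Omega -> R) :
  (forall i, P.-integrable setT (EFin \o f i)) ->
  P.-integrable setT (EFin \o (fun w => cell_mean (f^~ w))).
Proof.
move=> fi; apply: (@linear_form_integrable _ _ _ P _ predT
  (fun h => cell_mean h)) => //.
apply: linear_formZ; apply: linear_form_sum => i _.
exact: (@linear_form_eval _ _ predT i).
Qed.

Lemma integrable_Y0cell g t : (1 <= t <= T)%N ->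
  P.-integrable setT (EFin \o Y0cell X g t).
Proof. by move=> tT; apply: integrable_cell_mean => i; case: (hint i tT). Qed.

Lemma integrable_Y1cell g t : (1 <= t <= T)%N ->
  P.-integrable setT (EFin \o Y1cell X g t).
Proof. by move=> tT; apply: integrable_cell_mean => i; case: (hint i tT). Qed.

(** On each of the two events of the true status, [Yobs] is a single potential outcome. *)
Lemma integrable_Ycell g t : (1 <= t <= T)%N ->
  P.-integrable setT (EFin \o Ycell X g t).
Proof.
move=> tT; apply: integrable_cell_mean => i; have [iY0 iY1] := hint i tT.
have mD := measurable_bool_event (Dstar i).
apply: (@integrable_fibers _ _ _ P _ (Dstar i) [:: true; false]) => //.
  by move=> w; case: (Dstar i w).
move=> b; apply: (@eq_integrable _ _ _ _ _ (mD b)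
  (EFin \o (if b then Y1 i else Y0 i))).
  move=> w /set_mem /= Dw; rewrite /Yobs Dw.
  by case: b {Dw}; rewrite /= ?subrr ?subr0 !mul0r !mul1r ?addr0 ?add0r.
by apply: (integrableS measurableT) => //; case: b.
Qed.

Lemma integrable_change (y : 'I_G -> nat -> Omega -> R) (p : 'I_G * nat) :
  (forall g t, (1 <= t <= T)%N -> P.-integrable setT (EFin \o y g t)) ->
  observed_change T p ->
  P.-integrable setT (EFin \o (fun w => change (fun g t => y g t w) p)).
Proof.
case: p => g t yi /= pT; rewrite /observed_change /= in pT.
by apply: (integrableB measurableT (f := EFin \o y g t)
  (g := EFin \o y g t.-1)); apply: yi; lia.
Qed.

Lemma DID_S_integrable : P.-integrable setT (EFin \o DID_S X T).
Proof.
apply: (integrable_fibers (P := P) (measurable_Dall_fiber X (T:=T))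
  (Dall_in_range X T)) => v.
have mB := measurable_Dall_fiber X v.
(* [w0] freezes the coefficients on the fiber, leaving a fixed combination of integrable changes. *)
have [->|/set0P[w0 w0v]] := eqVneq (Dall X T @^-1` [set v]) set0.
  exact: integrable_set0.
apply: (@eq_integrable _ _ _ _ _ mB (EFin \o (fun w =>
  did_form X T w0 (change (fun g t => Ycell X g t w))))).
  move=> w /set_mem /= wv; congr EFin; rewrite DID_S_form.
  by apply: did_form_eq; rewrite w0v wv.
apply: (linear_form_integrable (did_form_linear X T w0)
  (h := fun p w => change (fun g t => Ycell X g t w) p)) => // p pT.
apply: (integrableS measurableT) => //.
by apply: (integrable_change (y := Ycell X)) => //; exact: integrable_Ycell.
Qed.

Lemma switchers_mean_effect_integrable : balanced_panel X T ->
  P.-integrable setT (EFin \o switchers_mean_effect X T).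
Proof.
move=> bal.
apply: (integrable_fibers (P := P) (measurable_Dall_fiber X (T:=T))
  (Dall_in_range X T)) => v.
have mB := measurable_Dall_fiber X v.
have [->|/set0P[w0 w0v]] := eqVneq (Dall X T @^-1` [set v]) set0.
  exact: integrable_set0.
apply: (@eq_integrable _ _ _ _ _ mB (EFin \o (fun w => switchers_form X T w0
  (fun p => Y1cell X p.1 p.2 w - Y0cell X p.1 p.2 w)))).
  move=> w /set_mem /= wv; congr EFin; rewrite switchers_mean_effect_form//.
  by apply: switchers_form_eq; rewrite w0v wv.
apply: (linear_form_integrable (switchers_form_linear X T w0)
  (h := fun p w => Y1cell X p.1 p.2 w - Y0cell X p.1 p.2 w)) => // -[g t] pT.
rewrite /observed_change /= in pT.
apply: (integrableS measurableT) => //.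
by apply: (integrableB measurableT (f := EFin \o Y1cell X g t)
  (g := EFin \o Y0cell X g t)); [apply: integrable_Y1cell|
  apply: integrable_Y0cell]; lia.
Qed.

(** Mean independence in [t] and [t - 1] replaces the whole design by the group's own statuses; the
    difference is then the conditional mean trend, which strong exogeneity makes unconditional. *)
Lemma Rintegral_trend_fiber g t v : (2 <= t <= T)%N ->
  mean_independence_at X T t -> mean_independence_at X T t.-1 ->
  strong_exogeneity X T -> P (Dall X T @^-1` [set v]) != 0%E ->
  \int[P]_(w in Dall X T @^-1` [set v]) trend X g t w =
  fine 'E_P[trend X g t]%E * fine (P (Dall X T @^-1` [set v])).
Proof.
move=> t2T mi mi' exo; set B := _ @^-1` _ => PB0.
have mB : measurable B := measurable_Dall_fiber X v.
have iY u (C : set Omega) : (1 <= u <= T)%N -> measurable C ->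
    P.-integrable C (EFin \o Y0cell X g u).
  move=> uT mC; apply: (integrableS measurableT) => //.
  exact: integrable_Y0cell.
have t1T : (1 <= t <= T)%N by lia.
have t0T : (1 <= t.-1 <= T)%N by lia.
have [w] := ae_witness mB PB0 (filterI (mi g) (filterI (mi' g) (exo g t t2T))).
rewrite /B /= => wv [mi_w [mi'_w exo_w]].
have PBv : fine (P B) != 0 by rewrite fine_eq0// fin_num_measure.
have meanE u : cond_exp P (Y0cell X g u) (Dall X T) w =
      cond_exp P (Y0cell X g u) (Dgroup X T g) w ->
    \int[P]_(w in B) Y0cell X g u w =
      cond_exp P (Y0cell X g u) (Dgroup X T g) w * fine (P B).
  by move=> <-; rewrite /cond_exp wv divfK.
rewrite -exo_w /= /trend RintegralB ?iY// !meanE// -mulrBl; congr (_ * _).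
have mC := measurable_Dgroup_fiber X g (Dgroup X T g w).
by rewrite /cond_exp RintegralB ?mulrBl//; exact: iY.
Qed.

End Expectation.

(** * Equality of the expectations *)

Theorem proposition5 (d : measure_display) (Omega : measurableType d)
    (R : realType) (P : probability Omega R) (G T : nat) (X : panel P G)
    (hint : integrable_outcomes X T)
    (hbal : balanced_panel X T)
    (hsharp : sharp_design X T)
    (hmi : forall t : nat, (2 <= t <= T)%N -> mean_independence_at X T t)
    (hmi1 : mean_independence_at X T 1)
    (hexo : strong_exogeneity X T)
    (hpt : parallel_trends X T)
    (hstag : staggered_adoption X T)
    (hmis : misclassification_patterns X T)
    (hcomp : comparison_groups_exist X T)
    (hnever : no_misclassification_never_treated X T)
    (hinit : no_initial_switch X) :
  'E_P[DID_S X T]%E = delta_S X T.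
Proof.
have iDID := DID_S_integrable hint.
have iS := switchers_mean_effect_integrable hint hbal.
pose bias w := DID_S X T w - switchers_mean_effect X T w.
have ibias : P.-integrable setT (EFin \o bias).
  exact: (integrableB measurableT iDID iS).
rewrite /delta_S expectation.unlock.
(* Both expectations are finite, so the claim becomes that the real integral of [bias] is 0. *)
rewrite -[LHS]fineK ?integrable_fin_num// -[RHS]fineK ?integrable_fin_num//.
congr EFin; apply/eqP; rewrite -subr_eq0 -RintegralB//; apply/eqP.
have mB (v : 'M[R]_(G, T)) := measurable_Dall_fiber X v.
have iB v (f : Omega -> R) : P.-integrable setT (EFin \o f) ->
    P.-integrable (Dall X T @^-1` [set v]) (EFin \o f).
  by move=> fi; apply: (integrableS measurableT).
rewrite (Rintegral_fibers mB (Dall_in_range X T)); last first.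
  by move=> v; exact: (iB v bias).
rewrite big1 // => v _.
(* Designs of probability zero, where conditional means are junk, contribute nothing. *)
have [PB0|PB0] := eqVneq (P (Dall X T @^-1` [set v])) 0%E.
  rewrite /Rintegral null_set_integral//.
  exact: (measurable_int _ (iB v bias ibias)).
have reg := ae_regular hbal hsharp hstag hmis hcomp hnever hinit.
have [w1 w1v _] := ae_witness (mB v) PB0 reg.
pose dY0 w := change (fun g t => Y0cell X g t w).
have idY0 p : observed_change T p ->
    P.-integrable (Dall X T @^-1` [set v]) (EFin \o (fun w => dY0 w p)).
  move=> pT; apply: iB; apply: (integrable_change (y := Y0cell X)) pT => //.
  exact: integrable_Y0cell.
(* On the fiber, [bias] is almost surely the form of the untreated changes with coefficients frozen
   at [w1]. *)
transitivity (\int[P]_(w in Dall X T @^-1` [set v]) did_form X T w1 (dY0 w)).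
  congr fine; apply: ae_eq_integral => //.
  - exact: (measurable_int _ (iB v bias ibias)).
  - apply: measurable_int; exact: (linear_form_integrable
      (did_form_linear X T w1) (mB v) (h := fun p w => dY0 w p)) idY0.
  - apply: filterS reg => w reg_w /= wv.
    rewrite DID_S_regular//; congr EFin; apply: did_form_eq.
    by rewrite wv w1v.
rewrite (linear_form_Rintegral (did_form_linear X T w1) (mB v)
  (h := fun p w => dY0 w p))//.
(* Each integrated change is the mean trend times the probability of the fiber, hence equal across
   groups by parallel trends. *)
apply: did_form_common => // g k t t2T.
have hmi' : mean_independence_at X T t.-1.
  (* For [t = 2] the earlier period is 1, which [hmi1] covers. *)
  have [->|t3] : t = 2%N \/ (2 <= t.-1 <= T)%N by lia.
    exact: hmi1.
  exact: hmi.
rewrite -/(trend X g t) -/(trend X k t).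
by rewrite !(Rintegral_trend_fiber hint _ t2T (hmi t t2T) hmi')// (hpt g k).
Qed.
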